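(* Let $n\in\mathbb{N}$ ($n\ge 1$), let $n-1<\alpha\le n$, and let $x_0\in\mathbb{R}$. On the set of real-valued functions $f$ that are $n$-differentiable in a neighborhood of $x_0$, the local fractional derivative of order $\alpha$ at $x_0$, i.e. the operator $f\mapsto({\cal D}^{\alpha}f)(x_0)$, is either the derivative of order $n$, i.e. $({\cal D}^{\alpha}f)(x_0)=f^{(n)}(x_0)$ for all such $f$, or the zero operator, i.e. $({\cal D}^{\alpha}f)(x_0)=0$ for all such $f$.
   Context: A function $f$ is called $n$-differentiable in a neighborhood of $x_0$ if it has a derivative of order $n$ in some neighborhood $U(x_0)$ of $x_0$. For $n-1<\alpha\le n$ the left-sided Riemann-Liouville fractional derivative of order $\alpha$ with base point $x_0$ is $${}_{x_0}^{RL}{\cal D}^{\alpha}_x f(x)=\frac{1}{\Gamma(n-\alpha)}\frac{d^n}{dx^n}\int_{x_0}^x\frac{f(z)\,dz}{(x-z)^{\alpha-n+1}},\qquad x>x_0,$$ with the convention that for $\alpha=n$ it is the ordinary derivative $d^n/dx^n$. The local fractional derivative of order $\alpha$ ($n-1<\alpha\le n$) of $f$ at the point $x_0$ is $$({\cal D}^{\alpha}f)(x_0)=\lim_{x\to x_0+}\; {}_{x_0}^{RL}{\cal D}^{\alpha}_x\Big(f(x)-\sum_{k=0}^{n-1}\frac{f^{(k)}(x_0)}{k!}(x-x_0)^k\Big).$$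
   Formalization: The equalities are asserted for those n-differentiable f for which the limit defining the local fractional derivative exists (it fails for x^2 sin(1/x), n=α=1, x_0=0); existence is also proved when f^(n) is continuous near x_0. *)

(* Defs.v *)
From HB Require Import structures.
From mathcomp Require Import all_boot all_order all_algebra.
From mathcomp Require Import all_classical all_reals all_analysis.
Import Order.TTheory GRing.Theory Num.Theory.
Import numFieldNormedType.Exports.

Set Implicit Arguments.
Unset Strict Implicit.
Unset Printing Implicit Defensive.

Local Open Scope ring_scope.
Local Open Scope classical_set_scope.

Section LocalFractionalDerivative.
Context {R : realType}.
Implicit Types (f : R -> R) (alpha x : R) (n : nat).

(* [f^`(k)] is total, so the derivatives below order n are required explicitly.
   This pointwise condition is only used at all points of an open set, where it
   says that f has a derivative of order n there. *)
Definition derivable_upto n f x : Prop :=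
  forall k : nat, (k < n)%N -> derivable (f^`(k)) x 1.

Definition n_differentiable_near n (x0 : R) f : Prop :=
  \forall x \near x0, derivable_upto n f x.

Definition n_continuously_differentiable_near n (x0 : R) f : Prop :=
  \forall x \near x0, derivable_upto n f x /\ {for x, continuous (f^`(n))}.

Definition Gamma (s : R) : R :=
  \int[lebesgue_measure]_(t in `]0, +oo[) (t `^ (s - 1) * expR (- t)).

(* The value at z = x is 0 and plays no role in the integral. *)
Definition RL_integrand n alpha f x (z : R) : R :=
  f z / (x - z) `^ (alpha - n%:R + 1).

Definition RL_integral n alpha (x0 : R) f x : R :=
  \int[lebesgue_measure]_(z in `[x0, x]) RL_integrand n alpha f x z.

(* To be read for n - 1 < alpha <= n and x > x0. *)
Definition RL_derivative n alpha (x0 : R) f x : R :=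
  if alpha == n%:R then f^`(n) x
  else (Gamma (n%:R - alpha))^-1 * ((RL_integral n alpha x0 f)^`(n))%classic x.

Definition RL_derivable n alpha (x0 : R) f x : Prop :=
  if alpha == n%:R then derivable_upto n f x
  else lebesgue_measure.-integrable `[x0, x]
         (EFin \o RL_integrand n alpha f x)
       /\ derivable_upto n (RL_integral n alpha x0 f) x.

Definition taylor_remainder n (x0 : R) f x : R :=
  f x - \sum_(k < n) (f^`(k))%classic x0 / (k`!)%:R * (x - x0) ^+ k.

(* [lim] is total: the value is meaningful under [local_frac_derivable]. *)
Definition local_frac_derivative n alpha f (x0 : R) : R :=
  lim (RL_derivative n alpha x0 (taylor_remainder n x0 f) x @[x --> x0^'+]).

Definition local_frac_derivable n alpha f (x0 : R) : Prop :=
  (\forall x \near x0^'+, RL_derivable n alpha x0 (taylor_remainder n x0 f) x)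
  /\ cvg (RL_derivative n alpha x0 (taylor_remainder n x0 f) x @[x --> x0^'+]).

End LocalFractionalDerivative.

(* Main.v *)
Require Import Defs.
From HB Require Import structures.
From mathcomp Require Import all_boot all_order all_algebra.
From mathcomp Require Import all_classical all_reals all_analysis.
From mathcomp Require Import measurable_realfun ring lra.
Import Order.TTheory GRing.Theory Num.Theory.
Import numFieldNormedType.Exports.
Local Open Scope ring_scope.
Local Open Scope classical_set_scope.

(** Which alternative holds depends on alpha only: the operator is the [n]-th
    derivative when [alpha = n], and it is zero when [n - 1 < alpha < n].

    Write [g] for the Taylor remainder of [f] at [x0], so that [g] and its
    derivatives below order [n] vanish at [x0].  As [g^(n-1)] is differentiable
    at [x0], the mean value theorem makes [g^(k)] an [O((x - x0)^(n - k))] for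
    every [k < n] (deriv_chain_flat_bound).

    Let [alpha < n] and [e = alpha - n + 1], so [0 < e < 1].  The substitution
    [z = x0 + s t] moves the singularity of the kernel to a fixed place:
    the fractional integral of [g] at [x0 + s] equals [s^(1 - e)] times the
    average over [t] in the unit interval of [g (x0 + s t)] against the
    integrable weight [(1 - t)^-e] (RL_integral_average).  Hence it is
    [O(s^(n + 1 - e))], which is [o(s^n)].

    If [f^(n)] is continuous near [x0], the average can be differentiated [n]
    times under the integral sign (is_derive_abel_average); its derivative of
    order [k] is [O(s^(n - k))], and by the Leibniz rule (powR_mul_chain) the
    [n]-th derivative of the product with [s^(1 - e)] is [O(s^(1 - e))]: it
    exists and tends to [0].

    If [f^(n)] merely exists, the fractional derivative is assumed to have a
    limit.  If a function is [O(s^(n + beta))] with [beta > 0] and its [n]-th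
    derivative has a limit [L] on the right of [x0], then [L = 0]
    (deriv_chain_lim0): otherwise, for small [h], its
    [n]-th finite difference of step [h] would be at least of size
    [|L| h^n / 2], whereas it is a fixed combination of [n + 1] values which are
    all [o(h^n)].

    For [alpha = n] the fractional derivative of [g] is [f^(n)] itself, and a
    derivative which has a one-sided limit at a point takes that limit as its
    value there, by the mean value theorem (deriv_chain_lim_right). *)

(** * Successive derivatives and finite differences *)

Section chains.
Set Implicit Arguments.
Unset Strict Implicit.
Context {R : realType}.
Implicit Types (f : R -> R) (A : set R) (D E : nat -> R -> R).

(** The successive derivatives are carried as an explicit family: sums, products
    and translates of such families are again families of the same kind.
    Iterated derivatives are compared with the family only once, on an open
    set. *)
Definition deriv_chain m A D : Prop :=
  forall k, (k < m)%N -> forall x, A x -> is_derive x 1 (D k) (D k.+1 x).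

Lemma deriv_chain_derive1n m A D f : open A -> deriv_chain m A D ->
  (forall x, A x -> f x = D 0 x) ->
  forall k, (k <= m)%N -> forall x, A x -> (f^`(k)) x = D k x.
Proof.
move=> oA cD fD; elim=> [|k IH] km x Ax; first by rewrite derive1n0 fD.
rewrite derive1nS derive1E.
have dk := cD k km x Ax.
rewrite (@near_eq_derive _ _ _ _ (D k)) ?derive_val//.
near=> y; apply: IH; first exact: ltnW.
by near: y; exact: open_nbhs_nbhs.
Unshelve. all: by end_near. Qed.

Lemma deriv_chain_derivable m A D f x : open A -> deriv_chain m A D ->
  (forall y, A y -> f y = D 0 y) -> A x -> derivable_upto m f x.
Proof.
move=> oA cD fD Ax k km.
have dk := cD k km x Ax.
apply: (@near_eq_derivable _ _ _ (D k)) => //.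
near=> y; apply/esym; apply: (deriv_chain_derive1n oA cD fD (ltnW km)).
by near: y; exact: open_nbhs_nbhs.
Unshelve. all: by end_near. Qed.

Lemma derivable_upto_chain m A f :
  (forall x, A x -> derivable_upto m f x) -> deriv_chain m A (fun k => f^`(k)).
Proof.
move=> fA k km x Ax; rewrite derive1nS derive1E.
exact/derivableP/fA.
Qed.

Lemma deriv_chainS m A A' D : A' `<=` A -> deriv_chain m A D ->
  deriv_chain m A' D.
Proof. by move=> AA cD k km x /AA Ax; exact: cD. Qed.

(** The Leibniz rule keeps orders of magnitude: a factor [s^gamma] shifts the
    order at [0] of every derivative by [gamma].  The first derivative of the
    product is [gamma s^(gamma - 1) v + s^gamma v'], and both terms have the
    shape of the statement one order lower: with exponents [gamma - 1] and [p]
    for the first, [gamma] and [p - 1] for the second. *)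
Lemma powR_mul_chain m (gamma p M delta : R) D :
  deriv_chain m `]0, delta[ D ->
  (forall k, (k <= m)%N -> forall s, `]0, delta[ s ->
     `|D k s| <= M * s `^ (p - k%:R)) ->
  exists E M', [/\ deriv_chain m `]0, delta[ E,
    forall s, E 0 s = s `^ gamma * D 0 s &
    forall s, `]0, delta[ s -> `|E m s| <= M' * s `^ (gamma + p - m%:R)].
Proof.
elim: m gamma p D => [|m IH] gamma p D cD bD.
  exists (fun _ s => s `^ gamma * D 0 s), M; split=> // s s0.
  rewrite normrM ger0_norm ?powR_ge0// subr0.
  have -> : s `^ (gamma + p) = s `^ gamma * s `^ p.
    have s_gt0 : 0 < s by move: s0; rewrite /= in_itv /= => /andP[].
    by rewrite powRD// (gt_eqF s_gt0) implybT.
  rewrite mulrCA ler_wpM2l ?powR_ge0//.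
  by have := bD 0 (leqnn 0) s s0; rewrite subr0.
have [E1 [M1 [c1 e1 b1]]] : exists E M', [/\ deriv_chain m `]0, delta[ E,
    forall s, E 0 s = s `^ (gamma - 1) * D 0 s &
    forall s, `]0, delta[ s -> `|E m s| <= M' * s `^ (gamma - 1 + p - m%:R)].
  apply: IH => [k km|k km]; first by apply: cD; exact: ltnW.
  by apply: bD; exact: leqW.
have [E2 [M2 [c2 e2 b2]]] : exists E M', [/\ deriv_chain m `]0, delta[ E,
    forall s, E 0 s = s `^ gamma * D 1 s &
    forall s, `]0, delta[ s -> `|E m s| <= M' * s `^ (gamma + (p - 1) - m%:R)].
  apply: (IH gamma (p - 1) (fun k => D k.+1)) => [k km|k km s s0].
    exact: (cD k.+1).
  have := bD k.+1 km s s0.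
  by rewrite -natr1 (_ : p - (k%:R + 1) = p - 1 - k%:R)//; ring.
exists (fun k s => if k is j.+1 then gamma * E1 j s + E2 j s
                   else s `^ gamma * D 0 s), (`|gamma| * M1 + M2); split=> //.
- case=> [_|k km] s s0 /=.
    have s_gt0 : 0 < s by move: s0; rewrite /= in_itv /= => /andP[].
    have d0 := cD 0 isT s s0.
    have dp := @is_derive1_powR _ gamma s s_gt0.
    apply: is_derive_eq.
    by rewrite e1 e2 /GRing.scale/=; ring.
  have d1 := c1 k km s s0; have d2 := c2 k km s s0.
  by apply: is_derive_eq; rewrite /GRing.scale.
- move=> s s0; rewrite (le_trans (ler_normD _ _))// mulrDl lerD//.
    rewrite normrM -mulrA ler_wpM2l//.
    have := b1 s s0.
    by rewrite -natr1 (_ : gamma - 1 + p - m%:R = gamma + p - (m%:R + 1))//; ring.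
  have := b2 s s0.
  by rewrite -natr1 (_ : gamma + (p - 1) - m%:R = gamma + p - (m%:R + 1))//; ring.
Qed.

Fixpoint fdiff n h f x : R :=
  if n is m.+1 then fdiff m h (fun y => f (y + h) - f y) x else f x.

(** Each difference trades one derivative for a factor [h], by the mean value
    theorem applied to the highest derivative. *)
Lemma fdiff_ge n : forall D (a b c h x : R), 0 < h ->
  deriv_chain n `]a, b[ D -> (forall y, `]a, b[ y -> c <= D n y) ->
  a < x -> x + n%:R * h < b -> c * h ^+ n <= fdiff n h (D 0) x.
Proof.
elim: n => [|n IH] D a b c h x h0 cD Dc ax xb.
  by rewrite expr0 mulr1 /=; apply: Dc; rewrite /= in_itv/= ax; lra.
rewrite exprS mulrA /=.
apply: (IH (fun k y => D k (y + h) - D k y) a (b - h)) => //.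
- move=> k kn y; rewrite /= in_itv/= => /andP[ay yb].
  have d1 : is_derive y 1 (D k) (D k.+1 y).
    by apply: cD; [exact: leqW | rewrite /= in_itv/=; lra].
  have d2 : is_derive (y + h) 1 (D k) (D k.+1 (y + h)).
    by apply: cD; [exact: leqW | rewrite /= in_itv/=; lra].
  have d3 : is_derive y 1 (fun z : R => D k (z + h)) (D k.+1 (y + h)).
    have ds : is_derive y 1 (fun z : R => z + h) 1.
      by apply: is_derive_eq; rewrite addr0.
    by have := @is_derive1_comp _ (D k) (fun z => z + h) y _ _ d2 ds; rewrite mulr1.
  by apply: is_derive_eq.
- move=> y; rewrite /= in_itv/= => /andP[ay yb].
  have itvP z : z \in `[y, y + h]%R -> is_derive z 1 (D n) (D n.+1 z).
    by rewrite in_itv/= => /andP[yz zh]; apply: cD => //=; rewrite in_itv/=; lra.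
  have yh : y < y + h by rewrite ltrDl.
  have dD z : z \in `]y, (y + h)%R[%R -> is_derive z 1 (D n) (D n.+1 z).
    by rewrite in_itv/= => zy; apply: itvP; rewrite in_itv/=; lra.
  have cDn : {within `[y, y + h], continuous (D n)}.
    by apply: derivable_within_continuous => z /itvP dz; exact: ex_derive.
  have [z zy ->] := MVT yh dD cDn.
  rewrite (_ : y + h - y = h); last by ring.
  rewrite ler_wpM2r ?(ltW h0)// Dc//= in_itv/=.
  by move: zy; rewrite in_itv/=; lra.
- by move: xb; rewrite -natr1; lra.
Qed.

Lemma fdiff_le n : forall f (B h x : R), 0 <= h ->
  (forall y, x <= y <= x + n%:R * h -> `|f y| <= B) ->
  `|fdiff n h f x| <= 2 ^+ n * B.
Proof.
elim: n => [|n IH] f B h x h0 fB.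
  by rewrite expr0 mul1r /=; apply: fB; lra.
rewrite exprSr -mulrA.
apply: IH => // y /andP[xy yx].
have ? : n.+1%:R * h = n%:R * h + h by rewrite -natr1 mulrDl mul1r.
have f1 : `|f (y + h)| <= B by apply: fB; lra.
have f2 : `|f y| <= B by apply: fB; lra.
by rewrite (le_trans (ler_normB _ _))//; lra.
Qed.

(** On the [n + 1] points [a + h], ..., [a + (n + 1) h] the function is at most
    of order [h^(n + beta)], while the [n]-th difference would be at least
    [c h^n]; letting [h] tend to [0] excludes [c > 0]. *)
Lemma deriv_chain_not_ge n D (a delta M beta c : R) : 0 < delta -> 0 < beta ->
  deriv_chain n `]a, (a + delta)[ D ->
  (forall x, `]a, (a + delta)[ x ->
     `|D 0 x| <= M * ((x - a) ^+ n * (x - a) `^ beta)) ->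
  (forall x, `]a, (a + delta)[ x -> c <= D n x) -> c <= 0.
Proof.
move=> d0 b0 cD bD Dc; rewrite leNgt; apply/negP => c0.
have M0 : 0 <= M.
  have ad : `]a, (a + delta)[%classic (a + delta / 2) by rewrite /= in_itv/=; lra.
  have := le_trans (normr_ge0 _) (bD _ ad).
  rewrite pmulr_lge0// mulr_gt0// ?exprn_gt0 ?powR_gt0//; lra.
have n0 : 0 < n.+1%:R :> R by rewrite ltr0n.
pose K : R := 2 ^+ n * (M * n.+1%:R ^+ n).
(* r is the distance from a to the farthest of the n + 1 points. *)
have cK r : 0 < r < delta -> c <= K * r `^ beta.
  move=> /andP[r0 rd]; pose h := r / n.+1%:R.
  have h0 : 0 < h by rewrite divr_gt0.
  have rE : r = n.+1%:R * h by rewrite /h mulrCA divff ?mulr1// gt_eqF.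
  have rE' : r = n%:R * h + h by rewrite rE -natr1 mulrDl mul1r.
  have H1 : c * h ^+ n <= fdiff n h (D 0) (a + h).
    by apply: (fdiff_ge h0 cD) => //; lra.
  have H2 : `|fdiff n h (D 0) (a + h)| <= 2 ^+ n * (M * (r ^+ n * r `^ beta)).
    apply: fdiff_le; first exact: ltW.
    move=> y ay; have ? : 0 <= n%:R * h by rewrite mulr_ge0 ?ler0n ?(ltW h0).
    apply: le_trans (bD y _) _; first by rewrite /= in_itv/=; lra.
    rewrite ler_wpM2l// ler_pM ?exprn_ge0 ?powR_ge0 ?lerXn2r ?nnegrE//; try lra.
    by apply: ge0_ler_powR; rewrite ?nnegrE; lra.
  have hn0 : 0 < h ^+ n by rewrite exprn_gt0.
  rewrite -(ler_pM2r hn0) (le_trans H1)// (le_trans (ler_norm _))//.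
  rewrite (le_trans H2)// /K [r ^+ n](_ : _ = n.+1%:R ^+ n * h ^+ n); last by rewrite -exprMn -rE.
  rewrite le_eqVlt; apply/orP; left.
  by apply/eqP; ring.
have /cvgrPdist_lt : K * r `^ beta @[r --> 0^'+] --> K * 0.
  by apply: cvgMl_tmp; exact: powR_cvg0.
move=> /(_ c c0) Kc.
suff : \forall r \near (0:R)^'+, False by move/(filter_ex)=> [].
near=> r.
have : `|K * 0 - K * r `^ beta| < c by near: r.
rewrite mulr0 sub0r normrN; apply/negP; rewrite -leNgt.
rewrite (le_trans _ (ler_norm _))// cK//; apply/andP; split; near: r.
  exact: nbhs_right_gt.
exact: nbhs_right_lt.
Unshelve. all: by end_near. Qed.

(** Taylor's formula read backwards: an [n]-th derivative cannot have a nonzero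
    limit at a point where the function vanishes to an order exceeding [n]. *)
Lemma deriv_chain_lim0 n D (a delta M beta L : R) : 0 < delta -> 0 < beta ->
  deriv_chain n `]a, (a + delta)[ D ->
  (forall x, `]a, (a + delta)[ x ->
     `|D 0 x| <= M * ((x - a) ^+ n * (x - a) `^ beta)) ->
  D n x @[x --> a^'+] --> L -> L = 0.
Proof.
move=> d0 b0; wlog L0 : D L / 0 <= L => [wlg cD bD DL|].
  have [|/ltW L0] := leP 0 L; first by move=> L0; exact: wlg DL.
  apply/eqP; rewrite -oppr_eq0; apply/eqP.
  apply: (wlg (fun k x => - D k x)); first by rewrite oppr_ge0.
  - by move=> k kn x ax; have dk := cD k kn x ax; apply: is_derive_eq.
  - by move=> x ax; rewrite normrN bD.
  - exact: cvgN.
move=> cD bD DL; apply/eqP; rewrite eq_le L0 andbT leNgt; apply/negP => L1.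
move/cvgrPdist_lt : DL => /(_ (L / 2)); rewrite divr_gt0// => /(_ isT)[r /= r0 rL].
pose d := Num.min r delta.
have dd : d <= delta by rewrite ge_min lexx orbT.
have dr : d <= r by rewrite ge_min lexx.
have sub : `]a, (a + d)[ `<=` `]a, (a + delta)[.
  by move=> x; rewrite /= !in_itv/=; lra.
have : L / 2 <= 0; last by lra.
apply: (@deriv_chain_not_ge n D a d M beta _ _ b0); first by rewrite lt_min r0.
- exact: deriv_chainS sub cD.
- by move=> x /sub; exact: bD.
- move=> x; rewrite /= in_itv/= => /andP[ax xd].
  have := rL x; rewrite /= distrC ger0_norm ?subr_ge0 ?(ltW ax)//.
  move=> /(_ ltac:(lra) ax); rewrite ltr_distl; lra.
Qed.

End chains.

(** * Affine change of variables in the Lebesgue integral *)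

Section affine.
Set Implicit Arguments.
Unset Strict Implicit.
Context {R : realType}.
Notation mu := (@lebesgue_measure R).
Implicit Types s : {posnum R}.

Definition affine (x0 s t : R) : R := x0 + s * t.

Lemma measurable_affine (x0 s : R) (D : set R) : measurable_fun D (affine x0 s).
Proof. by apply: measurable_funD => //; exact: measurable_funM. Qed.

Lemma affine_preimage_cc (x0 s : R) : 0 < s ->
  affine x0 s @^-1` `[x0, (x0 + s)] = `[0, 1].
Proof.
move=> s0; apply/seteqP; split=> t /=; rewrite /affine !in_itv/=.
  rewrite lerDl lerD2l pmulr_rge0// => /andP[-> ts]/=.
  by rewrite -(ler_pM2l s0) mulr1.
rewrite lerDl lerD2l pmulr_rge0// => /andP[-> t1]/=.
by rewrite -[leRHS]mulr1 ler_pM2l.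
Qed.

(** The scaling is put inside the pushforward so that the left-hand side is a
    measure and the uniqueness of the Lebesgue measure applies. *)
Lemma lebesgue_measure_affine (x0 : R) s (A : set R) : measurable A ->
  pushforward (mscale s%:num%:nng mu)
    (affine x0 s%:num : _ -> measurableTypeR R) A = mu A.
Proof.
have ms := @measurable_affine x0 s%:num setT.
move=> mA; apply/esym/lebesgue_measure_unique => //= _ [[a b]] _ <-.
rewrite /pushforward /mscale/=.
rewrite (_ : _ @^-1` _ = `](a - x0) / s%:num, (b - x0) / s%:num]%classic); last first.
  by apply/seteqP; split=> t /=; rewrite /affine !in_itv/= ltr_pdivrMr//
    ler_pdivlMr// ltrBlDl lerBrDl mulrC.
rewrite !lebesgue_measure_itv/= !lte_fin ltr_pM2r ?invr_gt0// ltrD2r.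
case: ifPn => _; last by rewrite mule0.
by rewrite -!EFinB -EFinM; congr EFin; field.
Qed.

Lemma ge0_integral_affine (x0 : R) s (F : R -> \bar R) :
  measurable_fun `[x0, (x0 + s%:num)] F -> (forall z, 0 <= F z)%E ->
  (\int[mu]_(z in `[x0, (x0 + s%:num)%R]) F z =
   s%:num%:E * \int[mu]_(t in `[0%R, 1%R]) F (affine x0 s%:num t))%E.
Proof.
move=> mF F0.
have ms := @measurable_affine x0 s%:num setT.
transitivity (\int[pushforward (mscale (s%:num%:nng)%R mu)
    (affine x0 s%:num : _ -> measurableTypeR R)]_(z in `[x0, (x0 + s%:num)%R]) F z)%E.
  by apply: eq_measure_integral => //= A mA AS; exact/esym/lebesgue_measure_affine.
rewrite ge0_integral_pushforward//= affine_preimage_cc// ge0_integral_mscale//.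
apply: (@measurable_comp _ _ _ _ _ _ `[x0, (x0 + s%:num)]%classic) => //.
- by move=> z [t t01 <-]; move: t01; rewrite -(affine_preimage_cc x0 (s := s%:num)).
- exact: measurable_affine.
Qed.

(** The positive and negative parts scale separately, and a positive factor
    distributes over a difference of extended reals even when both terms are
    infinite. *)
Lemma integral_affine (x0 : R) s (F : R -> \bar R) :
  measurable_fun `[x0, (x0 + s%:num)] F ->
  (\int[mu]_(z in `[x0, (x0 + s%:num)%R]) F z =
   s%:num%:E * \int[mu]_(t in `[0%R, 1%R]) F (affine x0 s%:num t))%E.
Proof.
move=> mF; rewrite integralE [in RHS]integralE.
rewrite !ge0_integral_affine//; [|exact: measurable_funeneg|exact: measurable_funepos].
have muleBr_gt0 (r : R) (u v : \bar R) : 0 < r ->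
    (r%:E * u - r%:E * v = r%:E * (u - v))%E.
  move=> r0; have r0' : (0 < r%:E)%E by rewrite lte_fin.
  by case: u v => [u| |] [v| |]; rewrite /= ?(gt0_muley r0') ?(gt0_muleNy r0')//=;
    congr EFin; ring.
rewrite muleBr_gt0//; congr (_ * (_ - _))%E;
  by apply: eq_integral => t _; rewrite ?funeposE ?funenegE.
Qed.

Lemma integrable_affine (x0 : R) s (F : R -> R) :
  measurable_fun `[x0, (x0 + s%:num)] F ->
  mu.-integrable `[0, 1] (EFin \o (fun t => F (affine x0 s%:num t))) ->
  mu.-integrable `[x0, (x0 + s%:num)] (EFin \o F).
Proof.
move=> mF iF; apply/integrableP; split; first exact/measurable_EFinP.
rewrite ge0_integral_affine//; last first.
  by apply/measurableT_comp => //; exact/measurable_EFinP.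
by rewrite lte_mul_pinfty ?lee_fin//; case/integrableP : iF.
Qed.

Lemma Rintegral_affine (x0 : R) s (F : R -> R) :
  measurable_fun `[x0, (x0 + s%:num)] F ->
  mu.-integrable `[0, 1] (EFin \o (fun t => F (affine x0 s%:num t))) ->
  \int[mu]_(z in `[x0, (x0 + s%:num)]) F z =
   s%:num * \int[mu]_(t in `[0, 1]) F (affine x0 s%:num t).
Proof.
move=> mF iF; rewrite /Rintegral integral_affine; last exact/measurable_EFinP.
by rewrite fineM// integrable_fin_num.
Qed.

End affine.

(** * The Abel kernel on the unit interval *)

Section abel_kernel.
Set Implicit Arguments.
Unset Strict Implicit.
Context {R : realType}.
Notation mu := (@lebesgue_measure R).
Variable e : R.
Hypothesis e01 : 0 < e < 1.

Definition abel_kernel (t : R) : R := ((1 - t) `^ e)^-1.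

Let e1 : 0 < 1 - e. Proof. by rewrite subr_gt0; case/andP: e01. Qed.

Lemma abel_kernel_ge0 t : 0 <= abel_kernel t.
Proof. by rewrite invr_ge0 powR_ge0. Qed.

Lemma measurable_abel_kernel (D : set R) : measurable_fun D abel_kernel.
Proof.
rewrite (_ : abel_kernel = (@powR R ^~ (- e)) \o (fun t => 1 - t)); last first.
  by apply/funext => t; rewrite /= powRN.
apply: measurable_funTS; apply: measurableT_comp; first exact: measurable_powR.
exact: measurable_funB.
Qed.

Lemma is_derive_abel_primitive (t : R) : t < 1 ->
  is_derive t 1 (fun u => - (1 - e)^-1 * (1 - u) `^ (1 - e)) (abel_kernel t).
Proof.
move=> t1.
have d1 : is_derive t 1 (fun u : R => 1 - u) (-1).
  by apply: is_derive_eq; rewrite add0r mul1r.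
have d2 : is_derive (1 - t) 1 (@powR R ^~ (1 - e)) ((1 - e) * (1 - t) `^ (1 - e - 1)).
  by apply: is_derive1_powR; lra.
have d3 : is_derive t 1 (fun u : R => (1 - u) `^ (1 - e)) _ :=
  @is_derive1_comp _ _ (fun u => 1 - u) _ _ _ d2 d1.
apply: is_derive_eq.
rewrite (_ : 1 - e - 1 = - e); last by ring.
rewrite powRN /abel_kernel /GRing.scale/=.
set k := ((1 - t) `^ e)^-1; field.
by rewrite gt_eqF.
Qed.

Lemma integral_abel_kernel_le (r : R) : 0 < r < 1 ->
  (\int[mu]_(t in `[0%R, r]) (abel_kernel t)%:E <= ((1 - e)^-1)%:E)%E.
Proof.
move=> /andP[r0 r1].
pose F u : R := - (1 - e)^-1 * (1 - u) `^ (1 - e).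
have dF (t : R) : t < 1 -> is_derive t 1 F (abel_kernel t) by exact: is_derive_abel_primitive.
have cF (t : R) : t < 1 -> {for t, continuous F}.
  by move=> /dF dt; apply/differentiable_continuous/derivable1_diffP; exact: ex_derive.
rewrite (@continuous_FTC2 _ _ F)//.
- rewrite -EFinB lee_fin /F subr0 powR1 mulr1 opprK -[leRHS]add0r lerD2r.
  by rewrite mulNr oppr_le0 mulr_ge0 ?powR_ge0// invr_ge0 ltW.
- apply: derivable_within_continuous => t; rewrite in_itv/= => /andP[t0 tr].
  have d1 : is_derive t 1 (fun u : R => 1 - u) (-1).
    by apply: is_derive_eq; rewrite add0r mul1r.
  have d2 : is_derive (1 - t) 1 (@powR R ^~ (- e)) (- e * (1 - t) `^ (- e - 1)).
    by apply: is_derive1_powR; lra.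
  have d3 := @is_derive1_comp _ _ (fun u => 1 - u) _ _ _ d2 d1.
  rewrite (_ : abel_kernel = (@powR R ^~ (- e)) \o (fun t => 1 - t)); first by case: d3.
  by apply/funext => u; rewrite /= powRN.
- split.
  + by move=> t; rewrite in_itv/= => /andP[_ tr]; have dt := dF t (lt_trans tr r1);
      exact: ex_derive.
  + by apply: cvg_at_right_filter; exact: cF.
  + by apply: cvg_at_left_filter; exact: cF.
- move=> t; rewrite in_itv/= => /andP[_ tr].
  by have dt := dF t (lt_trans tr r1); rewrite derive1E derive_val.
Qed.

(** The primitive [- (1 - t)^(1 - e) / (1 - e)] bounds the integral over every
    compact interval ending before the singularity; the bound passes to the
    limit by monotone convergence. *)
Lemma integrable_abel_kernel : mu.-integrable `[0, 1] (EFin \o abel_kernel).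
Proof.
apply/integrableP; split; first by apply/measurable_EFinP; exact: measurable_abel_kernel.
under eq_integral => t _ do rewrite /= (ger0_norm (abel_kernel_ge0 t)).
rewrite -integral_itv_bndo_bndc; last first.
  by apply/measurable_EFinP; exact: measurable_abel_kernel.
pose r i : R := 1 - i.+2%:R^-1.
have r01 i : 0 < r i < 1.
  rewrite /r subr_gt0 ltrBlDr ltrDl invr_gt0 ltr0n andbT.
  by rewrite invf_lt1 ?ltr0n// ltr1n.
pose F i : set R := `[0, r i].
have F_ndecr : {homo F : n m / (n <= m)%N >-> (n <= m)%O}.
  move=> i j ij; apply/subsetPset => t; rewrite /F/= !in_itv/= => /andP[-> tr]/=.
  by rewrite (le_trans tr)// lerD2l lerN2 lef_pV2 ?posrE ?ltr0n// ler_nat !ltnS.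
have FU : `[0, 1[%classic = \bigcup_i F i.
  apply/seteqP; split=> t; last first.
    move=> [i _]; rewrite /F/= !in_itv/= => /andP[-> tr]/=.
    by rewrite (le_lt_trans tr)//; case/andP: (r01 i).
  rewrite /= in_itv/= => /andP[t0 t1].
  exists (Num.truncn (1 - t)^-1) => //; rewrite /F/= in_itv/= t0/= /r.
  rewrite lerBrDr -lerBrDl -[leRHS]invrK lef_pV2 ?posrE ?ltr0n ?invr_gt0 ?subr_gt0//.
  apply: le_trans (ltW (truncnS_gt _)) _.
  by rewrite ler_nat.
have cvgF : (\int[mu]_(t in F i) (abel_kernel t)%:E @[i --> \oo] -->
    \int[mu]_(t in `[0%R, 1%R[) (abel_kernel t)%:E)%E.
  rewrite FU; apply: ge0_nondecreasing_set_cvg_integral => //.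
  - by move=> i; exact: measurable_itv.
  - by move=> i; apply/measurable_EFinP; exact: measurable_abel_kernel.
  - by move=> i t _; rewrite lee_fin abel_kernel_ge0.
rewrite -(cvg_lim _ cvgF)//.
apply: (@le_lt_trans _ _ ((1 - e)^-1)%:E); last by rewrite ltry.
apply: lime_le; first by apply/cvg_ex; eexists; exact: cvgF.
by apply: nearW => i; exact: integral_abel_kernel_le.
Qed.

Definition abel_mass : R := \int[mu]_(t in `[0, 1]) abel_kernel t.

Lemma integrable_abelM (phi : R -> R) M : measurable_fun (`[0, 1] : set R) phi ->
  (forall t, 0 <= t <= 1 -> `|phi t| <= M) ->
  mu.-integrable `[0, 1] (EFin \o (fun t => phi t * abel_kernel t)).
Proof.
move=> mphi phiM.
have iM : mu.-integrable `[0, 1] (EFin \o (fun t => M * abel_kernel t)).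
  rewrite (_ : _ \o _ = (fun t => M%:E * (EFin \o abel_kernel) t)%E)//.
  by apply: integrableZl => //; exact: integrable_abel_kernel.
apply: (le_integrable _ _ _ iM) => //.
- apply/measurable_EFinP/measurable_funM => //; exact: measurable_abel_kernel.
- move=> t; rewrite /= in_itv/= => t01.
  rewrite lee_fin !normrM ler_wpM2r// (le_trans (phiM _ t01))//; exact: ler_norm.
Qed.

Lemma Rintegral_abelM_le (phi : R -> R) M : measurable_fun (`[0, 1] : set R) phi ->
  (forall t, 0 <= t <= 1 -> `|phi t| <= M) ->
  `|\int[mu]_(t in `[0, 1]) (phi t * abel_kernel t)| <= M * abel_mass.
Proof.
move=> mphi phiM; have iphi := integrable_abelM mphi phiM.
have iM : mu.-integrable `[0, 1] (EFin \o (fun t => M * abel_kernel t)).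
  by apply: (integrable_abelM (M := `|M|)) => //; exact: measurable_cst.
rewrite (le_trans (le_normr_Rintegral _ iphi))//.
rewrite /abel_mass -RintegralZl//; last exact: integrable_abel_kernel.
apply: le_Rintegral => //; first exact: integrable_norm.
move=> t; rewrite /= in_itv/= => t01.
by rewrite normrM (ger0_norm (abel_kernel_ge0 t)) ler_wpM2r ?abel_kernel_ge0// phiM.
Qed.

End abel_kernel.

(** * Weighted averages along a segment *)

Section average.
Set Implicit Arguments.
Unset Strict Implicit.
Context {R : realType}.
Notation mu := (@lebesgue_measure R).
Variable e : R.
Hypothesis e01 : 0 < e < 1.
Implicit Types (h : R -> R).

(** The weight [t^k] is what differentiating [h (x0 + s t)] in [s] produces. *)
Definition abel_average k h (x0 s : R) : R :=
  \int[mu]_(t in `[0, 1]) (t ^+ k * h (affine x0 s t) * abel_kernel e t).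

Lemma affine_itv (x0 s t : R) : 0 <= s -> 0 <= t <= 1 ->
  x0 <= affine x0 s t <= x0 + s.
Proof.
move=> s0 /andP[t0 t1]; rewrite /affine lerDl lerD2l mulr_ge0//=.
by rewrite -[leRHS]mulr1 ler_wpM2l.
Qed.

Lemma measurable_average k h (x0 s : R) : 0 <= s ->
  (forall z, x0 <= z <= x0 + s -> {for z, continuous h}) ->
  measurable_fun (`[0, 1] : set R) (fun t => t ^+ k * h (affine x0 s t)).
Proof.
move=> s0 ch; apply: subspace_continuous_measurable_fun => //.
apply: continuous_in_subspaceT => t; rewrite inE/= in_itv/= => t01.
apply: cvgM; first exact: exprn_continuous.
apply: (@continuous_comp _ _ _ (affine x0 s) h t); last exact/ch/affine_itv.
by apply: cvgD; [exact: cvg_cst|apply: cvgM; [exact: cvg_cst|exact: cvg_id]].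
Qed.

Lemma normr_exprM_le k h (x0 s B : R) : 0 <= s ->
  (forall z, x0 <= z <= x0 + s -> `|h z| <= B) ->
  forall t, 0 <= t <= 1 -> `|t ^+ k * h (affine x0 s t)| <= B.
Proof.
move=> s0 hB t t01; rewrite normrM normrX.
have hB' := hB _ (affine_itv x0 s0 t01).
case/andP: t01 => t0 t1.
rewrite (le_trans _ hB')// -[leRHS]mul1r ler_wpM2r// (ger0_norm t0).
exact: exprn_ile1.
Qed.

Lemma abel_average_le k h (x0 s B : R) : 0 <= s ->
  (forall z, x0 <= z <= x0 + s -> {for z, continuous h}) ->
  (forall z, x0 <= z <= x0 + s -> `|h z| <= B) ->
  `|abel_average k h x0 s| <= B * abel_mass e.
Proof.
move=> s0 ch hB; apply: Rintegral_abelM_le => //; first exact: measurable_average.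
exact: normr_exprM_le.
Qed.

(** Differentiation under the integral sign, dominated by [M] times the kernel;
    the domain of integration no longer depends on [s]. *)
Lemma is_derive_abel_average k h h' (x0 delta M s : R) :
  (forall z, x0 <= z < x0 + delta -> is_derive z 1 h (h' z)) ->
  (forall z, x0 <= z < x0 + delta -> `|h z| <= M) ->
  (forall z, x0 <= z < x0 + delta -> `|h' z| <= M) ->
  0 < s < delta ->
  is_derive s 1 (abel_average k h x0) (abel_average k.+1 h' x0 s).
Proof.
move=> dh hM h'M sd.
have dlt z r : 0 < r < delta -> x0 <= z <= x0 + r -> x0 <= z < x0 + delta.
  by lra.
pose f r t := t ^+ k * h (affine x0 r t) * abel_kernel e t.
have df r t : 0 < r < delta -> 0 <= t <= 1 ->
    is_derive r 1 (f ^~ t) (t ^+ k.+1 * h' (affine x0 r t) * abel_kernel e t).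
  move=> rd t01.
  have r0 : 0 <= r by lra.
  have d1 : is_derive r 1 (fun r => affine x0 r t) t.
    by apply: is_derive_eq; rewrite /GRing.scale/=; ring.
  have d2 := dh _ (dlt _ _ rd (affine_itv x0 r0 t01)).
  have d3 := @is_derive1_comp _ h (fun r => affine x0 r t) r _ _ d2 d1.
  apply: is_derive_eq.
  by rewrite /GRing.scale/= exprS; ring.
have intf r : `]0, delta[ r -> mu.-integrable `[0, 1] (EFin \o f r).
  rewrite /= in_itv/= => rd; have r0 : 0 <= r by lra.
  apply: (integrable_abelM e01 (M := M)).
    apply: measurable_average => // z /(dlt _ _ rd) /dh dz.
    by apply/differentiable_continuous/derivable1_diffP; exact: ex_derive.
  by apply: normr_exprM_le => // z /(dlt _ _ rd); exact: hM.
have derf r (t : R) : `]0, delta[ r -> `[0, 1] t -> derivable (f ^~ t) r 1.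
  by rewrite /= !in_itv/= => rd t01; have d := df r t rd t01; exact: ex_derive.
have M0 : 0 <= M by rewrite (le_trans _ (hM x0 _))//; lra.
have sI : `]0, delta[%classic s by rewrite /= in_itv.
have d1E r (t : R) : `]0, delta[ r -> `[0, 1] t -> partial1of2 f r t =
    t ^+ k.+1 * h' (affine x0 r t) * abel_kernel e t.
  rewrite /= !in_itv/= => rd t01.
  by rewrite partial1of2E; have d := df r t rd t01; rewrite derive_val.
have G0 t : 0 <= M * abel_kernel e t by rewrite mulr_ge0 ?abel_kernel_ge0.
have iG : mu.-integrable `[0, 1] (EFin \o (fun t => M * abel_kernel e t)).
  by apply: (integrable_abelM e01 (M := `|M|)) => //; exact: measurable_cst.
have fG r (t : R) : `]0, delta[ r -> `[0, 1] t ->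
    `|partial1of2 f r t| <= M * abel_kernel e t.
  move=> rI tI; rewrite d1E// normrM (ger0_norm (abel_kernel_ge0 e t)).
  rewrite ler_wpM2r ?abel_kernel_ge0//.
  move: rI tI; rewrite /= !in_itv/= => rd t01.
  apply: normr_exprM_le t01; first by lra.
  by move=> z /(dlt _ _ rd); exact: h'M.
have m01 : measurable (`[0, 1] : set R) by exact: measurable_itv.
rewrite (_ : abel_average k h x0 = (fun r => \int[mu]_(t in `[0, 1]) f r t))//.
split.
  exact: (@derivable_under_integral R _ (measurableTypeR R) mu f _ m01 s _ _ sI
    intf derf _ G0 iG fG).
rewrite -derive1E (@differentiation_under_integral R _ (measurableTypeR R) mu f
  _ m01 s _ _ sI intf derf _ G0 iG fG).
by apply: eq_Rintegral => t /set_mem tI; rewrite d1E.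
Qed.

End average.

(** * The Riemann-Liouville integral as an average *)

Section riemann_liouville.
Set Implicit Arguments.
Unset Strict Implicit.
Context {R : realType}.
Notation mu := (@lebesgue_measure R).
Variables (n : nat) (alpha : R).
Hypothesis alphan : n%:R - 1 < alpha < n%:R.
Let e := alpha - n%:R + 1.

Lemma RL_exponent01 : 0 < e < 1.
Proof. by case/andP: alphan => a0 a1; rewrite /e; apply/andP; split; lra. Qed.

Let e01 := RL_exponent01.

Lemma RL_integrand_affine g (x0 s t : R) : 0 < s -> 0 <= t <= 1 ->
  RL_integrand n alpha g (x0 + s) (affine x0 s t) =
  s `^ (- e) * (t ^+ 0 * g (affine x0 s t) * abel_kernel e t).
Proof.
move=> s0 /andP[t0 t1]; rewrite /RL_integrand -/e.
rewrite (_ : x0 + s - affine x0 s t = s * (1 - t)); last by rewrite /affine; ring.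
rewrite powRM ?subr_ge0// ?(ltW s0)// invfM -powRN expr0 mul1r /abel_kernel.
by rewrite mulrCA.
Qed.

Lemma measurable_RL_integrand (g : R -> R) (x0 s : R) :
  (forall z, x0 <= z <= x0 + s -> {for z, continuous g}) ->
  measurable_fun `[x0, (x0 + s)] (RL_integrand n alpha g (x0 + s)).
Proof.
move=> cg; apply: measurable_funM.
  apply: subspace_continuous_measurable_fun => //.
  by apply: continuous_in_subspaceT => z; rewrite inE/= in_itv/=; exact: cg.
rewrite (_ : (fun z => _) = (@powR R ^~ (- e)) \o (fun z => x0 + s - z)); last first.
  by apply/funext => z; rewrite /= powRN.
apply: measurable_funTS; apply: measurableT_comp; first exact: measurable_powR.
exact: measurable_funB.
Qed.

Lemma integrable_RL_affine (g : R -> R) (x0 s B : R) : 0 < s ->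
  (forall z, x0 <= z <= x0 + s -> {for z, continuous g}) ->
  (forall z, x0 <= z <= x0 + s -> `|g z| <= B) ->
  mu.-integrable `[0, 1]
    (EFin \o (fun t => RL_integrand n alpha g (x0 + s) (affine x0 s t))).
Proof.
move=> s0 cg gB; have s0' := ltW s0.
have iK : mu.-integrable `[0, 1] (fun t => (s `^ (- e))%:E *
    (EFin \o (fun t : R => t ^+ 0 * g (affine x0 s t) * abel_kernel e t)%R) t)%E.
  apply: integrableZl => //; apply: (integrable_abelM e01 (M := B)).
    exact: measurable_average.
  exact: normr_exprM_le.
apply: eq_integrable iK => //.
by move=> t; rewrite inE/= in_itv/= => t01; rewrite /= RL_integrand_affine.
Qed.

Lemma integrable_RL_integrand (g : R -> R) (x0 s B : R) : 0 < s ->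
  (forall z, x0 <= z <= x0 + s -> {for z, continuous g}) ->
  (forall z, x0 <= z <= x0 + s -> `|g z| <= B) ->
  mu.-integrable `[x0, (x0 + s)] (EFin \o RL_integrand n alpha g (x0 + s)).
Proof.
move=> s0 cg gB; apply: (integrable_affine (s := PosNum s0)) => /=.
  exact: measurable_RL_integrand.
exact: integrable_RL_affine gB.
Qed.

(** Under [z = x0 + s t] the kernel [(x - z)^-e] becomes [s^-e (1 - t)^-e] and
    [dz] contributes one more factor [s]. *)
Lemma RL_integral_average (g : R -> R) (x0 s B : R) : 0 < s ->
  (forall z, x0 <= z <= x0 + s -> {for z, continuous g}) ->
  (forall z, x0 <= z <= x0 + s -> `|g z| <= B) ->
  RL_integral n alpha x0 g (x0 + s) = s `^ (1 - e) * abel_average e 0 g x0 s.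
Proof.
move=> s0 cg gB; rewrite /RL_integral.
rewrite (Rintegral_affine (s := PosNum s0))/=; last 2 first.
- exact: measurable_RL_integrand.
- exact: integrable_RL_affine gB.
have -> : s `^ (1 - e) = s * s `^ (- e).
  by rewrite powRD ?(gt_eqF s0) ?implybT// powRr1 ?(ltW s0).
rewrite -[RHS]mulrA /abel_average.
rewrite -RintegralZl//; last first.
  apply: (integrable_abelM e01 (M := B)); first exact: measurable_average (ltW s0) cg.
  exact: normr_exprM_le (ltW s0) gB.
congr (s * _); apply: eq_Rintegral => t; rewrite inE/= in_itv/= => t01.
exact: RL_integrand_affine.
Qed.

End riemann_liouville.

(** * Taylor remainders *)

Section taylor.
Set Implicit Arguments.
Unset Strict Implicit.
Context {R : realType}.
Implicit Types (f : R -> R).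

Lemma is_derive_taylor_remainder m (x0 x : R) f : derivable f x 1 ->
  is_derive x 1 (taylor_remainder m.+1 x0 f) (taylor_remainder m x0 f^`() x).
Proof.
move=> /derivableP df; rewrite -derive1E in df.
pose p (i : 'I_m.+1) y : R := (f^`(i))%classic x0 / i`!%:R * (y - x0) ^+ i.
have dp (i : 'I_m.+1) : is_derive x 1 (p i)
   ((f^`(i))%classic x0 / i`!%:R * (i%:R * (x - x0) ^+ i.-1)).
  have d1 : is_derive x 1 (fun y : R => y - x0) 1.
    by apply: is_derive_eq; rewrite subr0.
  rewrite (_ : p i =
      ((f^`(i))%classic x0 / i`!%:R) *: (fun y : R => y - x0) ^+ i); last first.
    by apply/funext => y; rewrite /p /= exprfctE.
  by apply: is_derive_eq; rewrite /GRing.scale/= mulr1.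
have -> : taylor_remainder m.+1 x0 f = f - \sum_(i < m.+1) p i.
  by apply/funext => y; rewrite /taylor_remainder fctE fct_sumE.
apply: is_derive_eq; rewrite /taylor_remainder; congr (_ - _).
rewrite big_ord_recl/= mul0r mulr0 add0r; apply: eq_bigr => i _.
rewrite /bump leq0n add1n /= factS natrM -derive1Sn invfM.
rewrite mulrA; congr (_ * _); rewrite -!mulrA; congr (_ * _).
by rewrite mulrCA mulVf ?mulr1// pnatr_eq0.
Qed.

Lemma taylor_remainder0 (x0 x : R) f : taylor_remainder 0 x0 f x = f x.
Proof. by rewrite /taylor_remainder big_ord0 subr0. Qed.

Lemma taylor_remainder_center m (x0 : R) f : taylor_remainder m.+1 x0 f x0 = 0.
Proof.
rewrite /taylor_remainder big_ord_recl/= fact0 divr1 expr0 mulr1.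
rewrite big1 ?addr0 ?subrr// => i _.
by rewrite /bump leq0n add1n expr0n mulr0.
Qed.

(** The [k]-th derivative of a Taylor remainder of order [n] is the remainder of
    order [n - k] of the [k]-th derivative. *)
Definition taylor_chain n (x0 : R) f k := taylor_remainder (n - k) x0 (f^`(k)).

Lemma taylor_chainP n (x0 : R) f (A : set R) :
  (forall x, A x -> derivable_upto n f x) -> deriv_chain n A (taylor_chain n x0 f).
Proof.
move=> fA k kn x Ax; rewrite /taylor_chain -(subnSK kn) derive1nS.
exact/is_derive_taylor_remainder/fA.
Qed.

(** Differentiability of [D n] at [x0] bounds [D n] by a multiple of [x - x0];
    the mean value theorem then gains one power at each step down.  The range
    stops at [k = n] because [D n.+1] may be unbounded near [x0]. *)
Lemma deriv_chain_flat_bound n D (x0 delta : R) : 0 < delta ->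
  deriv_chain n.+1 `](x0 - delta), (x0 + delta)[ D ->
  (forall k, (k <= n)%N -> D k x0 = 0) ->
  exists M d, [/\ 0 < d <= delta, 0 <= M & forall k, (k <= n)%N -> forall x,
    x0 <= x < x0 + d -> `|D k x| <= M * (x - x0) ^+ (n.+1 - k)].
Proof.
move=> delta0 cD D0.
have itvP x : `](x0 - delta), (x0 + delta)[%classic x <-> x0 - delta < x < x0 + delta.
  by rewrite /= in_itv.
pose M := `|D n.+1 x0| + 1.
have M0 : 0 <= M by rewrite addr_ge0.
have [d d0 dM] : exists2 d, 0 < d & forall x, x0 <= x < x0 + d ->
    `|D n x| <= M * (x - x0).
  have dn : is_derive x0 1 (D n) (D n.+1 x0) by apply: cD => //; apply/itvP; lra.
  have : h^-1 *: (D n (h + x0) - D n x0) @[h --> 0^'] --> D n.+1 x0.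
    have := @ex_derive _ _ _ _ _ _ _ dn.
    rewrite -(@derive_val _ _ _ _ _ _ _ dn) -derive1E /derive1.
    rewrite /derivable; under eq_fun do rewrite scaler1.
    by [].
  move=> /cvgrPdist_lt/(_ 1 ltr01)[d /= d0 dM].
  exists d => // x /andP[xx0 xd].
  move: xx0; rewrite le_eqVlt => /predU1P[<-|xx0].
    by rewrite D0// normr0 subrr mulr0.
  have := dM (x - x0); rewrite /= sub0r normrN gtr0_norm ?subr_gt0//.
  move=> /(_ ltac:(lra)); rewrite subr_eq0 gt_eqF// => /(_ isT).
  rewrite subrK (D0 n)// subr0 => H.
  have : `|(x - x0)^-1 *: D n x| <= M.
    rewrite -lerBlDl; apply: le_trans (lerB_dist _ _) _.
    by rewrite distrC ltW.
  rewrite normrZ normfV gtr0_norm ?subr_gt0//.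
  by rewrite mulrC ler_pdivrMr ?subr_gt0.
exists M, (Num.min d delta); split=> //.
  by rewrite lt_min d0 delta0 ge_min lexx orbT.
have mind : Num.min d delta <= d by rewrite ge_min lexx.
have mindelta : Num.min d delta <= delta by rewrite ge_min lexx orbT.
move=> k kn; rewrite -(subKn kn).
elim: (n - k)%N (leq_subr k n) => [|j IH] jn x /andP[x0x xd].
  by rewrite subn0 subSnn expr1 dM//; lra.
move: x0x; rewrite le_eqVlt => /predU1P[<-|x0x].
  by rewrite D0 ?leq_subr// normr0 mulr_ge0// exprn_ge0// subrr.
have dD z : z \in `[x0, x]%R -> is_derive z 1 (D (n - j.+1)%N) (D (n - j)%N z).
  rewrite in_itv/= => zx; rewrite -(subnSK jn); apply: cD.
    by rewrite ltnS leq_subr.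
  by apply/itvP; lra.
have dDo z : z \in `]x0, x[%R -> is_derive z 1 (D (n - j.+1)%N) (D (n - j)%N z).
  by move=> zx; apply: dD; exact: subset_itv_oo_cc zx.
have cDn : {within `[x0, x], continuous (D (n - j.+1)%N)}.
  by apply: derivable_within_continuous => z /dD dz; exact: ex_derive.
have [z zx] := MVT x0x dDo cDn.
rewrite D0 ?leq_subr// subr0 => ->.
move: zx; rewrite in_itv/= => zx.
rewrite normrM (gtr0_norm (x := x - x0)) ?subr_gt0//.
rewrite subSn ?leq_subr// subKn// exprSr mulrA ler_wpM2r ?subr_ge0 ?(ltW x0x)//.
have := IH (ltnW jn) z ltac:(lra).
move=> /le_trans; apply; rewrite ler_wpM2l//.
rewrite subSn ?leq_subr// subKn ?(ltnW jn)//.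
by rewrite lerXn2r// ?nnegrE; lra.
Qed.

End taylor.

(** * Fractional derivatives of non-integer order *)

Section fractional.
Set Implicit Arguments.
Unset Strict Implicit.
Context {R : realType}.
Variables (n : nat) (alpha : R).
Hypothesis alphan : n%:R - 1 < alpha < n%:R.
Let e := alpha - n%:R + 1.
Let e01 : 0 < e < 1 := RL_exponent01 alphan.
Implicit Types (f g : R -> R) (D : nat -> R -> R) (delta M L : R).

Let alpha_neqn : (alpha == n%:R) = false.
Proof. by case/andP: alphan => _ /lt_eqF. Qed.

Let e1 : 0 < 1 - e. Proof. by case/andP: e01; rewrite subr_gt0. Qed.

Lemma RL_integral_flat_le g (x0 s : R) M : 0 < s ->
  (forall z, x0 <= z <= x0 + s -> {for z, continuous g}) ->
  (forall z, x0 <= z <= x0 + s -> `|g z| <= M * (z - x0) ^+ n) -> 0 <= M ->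
  `|RL_integral n alpha x0 g (x0 + s)| <=
    M * abel_mass e * (s ^+ n * s `^ (1 - e)).
Proof.
move=> s0 cg gM M0.
have gB z : x0 <= z <= x0 + s -> `|g z| <= M * s ^+ n.
  move=> zs; rewrite (le_trans (gM _ zs))// ler_wpM2l//.
  by rewrite lerXn2r ?nnegrE//; lra.
rewrite (RL_integral_average alphan s0 cg gB) normrM ger0_norm ?powR_ge0//.
have := abel_average_le e01 0 (ltW s0) cg gB.
rewrite -/e => H; rewrite mulrC.
rewrite (_ : M * abel_mass e * (s ^+ n * s `^ (1 - e)) =
  (M * s ^+ n * abel_mass e) * s `^ (1 - e)); last by ring.
by rewrite ler_wpM2r ?powR_ge0.
Qed.

(** The average has a [k]-th derivative of order [s^(n - k)], so the fractional
    integral, its product with [s^(1 - e)], has an [n]-th derivative of order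
    [s^(1 - e)].  Since [delta <= 1], the powers of [z - x0] are at most [1] and
    the single constant [M] dominates all the derivatives under the integral
    sign. *)
Lemma RL_derivative_flat D (x0 : R) delta M : 0 < delta <= 1 -> 0 <= M ->
  deriv_chain n `](x0 - delta), (x0 + delta)[ D ->
  (forall k, (k <= n)%N -> forall z, x0 <= z < x0 + delta ->
     {for z, continuous (D k)}) ->
  (forall k, (k <= n)%N -> forall z, x0 <= z < x0 + delta ->
     `|D k z| <= M * (z - x0) ^+ (n - k)) ->
  (forall x, x0 < x < x0 + delta -> RL_derivable n alpha x0 (D 0) x) /\
  RL_derivative n alpha x0 (D 0) x @[x --> x0^'+] --> (0 : R).
Proof.
move=> /andP[d0 d1] M0 cD contD bD.
have bDM k z : (k <= n)%N -> x0 <= z < x0 + delta -> `|D k z| <= M.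
  move=> kn zd; rewrite (le_trans (bD k kn z zd))// -[leRHS]mulr1 ler_wpM2l//.
  by rewrite exprn_ile1//; lra.
have cont s k : 0 < s < delta -> (k <= n)%N ->
    forall z, x0 <= z <= x0 + s -> {for z, continuous (D k)}.
  by move=> sd kn z zs; apply: contD => //; lra.
have bnd s k : 0 < s < delta -> (k <= n)%N ->
    forall z, x0 <= z <= x0 + s -> `|D k z| <= M * s ^+ (n - k).
  move=> sd kn z zs; rewrite (le_trans (bD k kn z _))//; first lra.
  by rewrite ler_wpM2l// lerXn2r ?nnegrE//; lra.
pose V k := abel_average e k (D k) x0.
have cV : deriv_chain n `]0, delta[ V.
  move=> k kn s; rewrite /= in_itv/= => sd.
  apply: (is_derive_abel_average e01 k (M := M) (delta := delta)) => //.
  - by move=> z zd; apply: cD => //; rewrite /= in_itv/=; lra.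
  - by move=> z zd; apply: bDM => //; exact: ltnW.
  - by move=> z zd; exact: bDM.
have bV k : (k <= n)%N -> forall s, `]0, delta[%classic s ->
    `|V k s| <= M * abel_mass e * s `^ (n%:R - k%:R).
  move=> kn s; rewrite /= in_itv/= => sd.
  have s0 : 0 <= s by lra.
  rewrite -natrB// powR_mulrn// mulrAC.
  by apply: (abel_average_le e01) => //; [exact: cont|exact: bnd].
have [E [M' [cE E0 bE]]] := powR_mul_chain (1 - e) cV bV.
pose A : set R := `]x0, (x0 + delta)[%classic.
have AE x : A x <-> x0 < x < x0 + delta by rewrite /A /= in_itv.
have oA : open A by exact: interval_open.
have cEx : deriv_chain n A (fun k x => E k (x - x0)).
  move=> k kn x /AE xd.
  have ds : is_derive x 1 (fun y : R => y - x0) 1.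
    by apply: is_derive_eq; rewrite subr0.
  have dE : is_derive (x - x0) 1 (E k) (E k.+1 (x - x0)).
    by apply: cE => //=; rewrite in_itv/=; lra.
  by have := @is_derive1_comp _ (E k) (fun y => y - x0) x _ _ dE ds; rewrite mulr1.
have JE x : A x -> RL_integral n alpha x0 (D 0) x = E 0 (x - x0).
  move=> /AE xd; have s0 : 0 < x - x0 by lra.
  have sd : 0 < x - x0 < delta by lra.
  rewrite E0 -[in LHS](subrK x0 x) addrC.
  exact: (RL_integral_average alphan s0 (cont _ _ sd (leq0n n)) (bnd _ _ sd (leq0n n))).
split=> [x xd|].
  rewrite /RL_derivable alpha_neqn; split; last first.
    by apply: deriv_chain_derivable oA cEx JE _; apply/AE.
  have s0 : 0 < x - x0 by lra.
  have sd : 0 < x - x0 < delta by lra.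
  have := integrable_RL_integrand alphan s0 (cont _ _ sd (leq0n n)) (bnd _ _ sd (leq0n n)).
  by rewrite addrC subrK.
have RLE x : A x -> RL_derivative n alpha x0 (D 0) x =
    (Gamma (n%:R - alpha))^-1 * E n (x - x0).
  move=> Ax; rewrite /RL_derivative alpha_neqn; congr (_ * _).
  exact: deriv_chain_derive1n oA cEx JE _ _ _ Ax.
pose C := `|(Gamma (n%:R - alpha))^-1| * M'.
have CE x : A x -> `|RL_derivative n alpha x0 (D 0) x| <= C * (x - x0) `^ (1 - e).
  move=> Ax; rewrite RLE// normrM /C -mulrA ler_wpM2l//.
  have := bE (x - x0); rewrite addrK; apply.
  by move/AE : Ax => Ax; rewrite /= in_itv/=; lra.
have powcvg : (x - x0) `^ (1 - e) @[x --> x0^'+] --> (0:R).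
  apply/cvgrPdist_lt => eps eps0.
  have /cvgrPdist_lt/(_ _ eps0)[r /= r0 powr] := powR_cvg0 e1.
  exists r => //= x xr xx0.
  by have := powr (x - x0); rewrite /= sub0r normrN subr_gt0 distrC; exact.
have Ccvg : C * (x - x0) `^ (1 - e) @[x --> x0^'+] --> (0:R).
  by rewrite -(mulr0 C); apply: cvgMl_tmp.
apply: norm_cvg0.
apply: (squeeze_cvgr _ (cvg_cst 0) Ccvg).
near=> x; rewrite normr_ge0/= CE//; apply/AE; apply/andP; split; near: x.
  exact: nbhs_right_gt.
by apply: nbhs_right_lt; lra.
Unshelve. all: by end_near. Qed.

(** The fractional integral is [O((x - x0)^(n + 1 - e))] by the bound on [g], so
    its [n]-th derivative can only tend to [0].  The case split is on whether the
    constant [(Gamma (n - alpha))^-1] in front is zero; if so, the fractional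
    derivative vanishes identically. *)
Lemma RL_derivative_flat_lim0 g (x0 : R) delta M L : 0 < delta -> 0 <= M ->
  (forall z, x0 <= z < x0 + delta -> {for z, continuous g}) ->
  (forall z, x0 <= z < x0 + delta -> `|g z| <= M * (z - x0) ^+ n) ->
  (\forall x \near x0^'+, RL_derivable n alpha x0 g x) ->
  RL_derivative n alpha x0 g x @[x --> x0^'+] --> L -> L = 0.
Proof.
move=> d0 M0 cg gM [r /= r0 RLd]; rewrite /RL_derivative alpha_neqn.
set c := (Gamma _)^-1 => RLL.
have [c0|c0] := eqVneq c 0.
  have cJ0 : c * ((RL_integral n alpha x0 g)^`(n))%classic x @[x --> x0^'+] --> (0:R).
    by rewrite c0; under eq_fun do rewrite mul0r; exact: cvg_cst.
  exact: (cvg_unique _ RLL cJ0).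
pose J := RL_integral n alpha x0 g.
pose d := Num.min r delta.
have d_gt0 : 0 < d by rewrite lt_min r0.
have dr : d <= r by rewrite ge_min lexx.
have dd : d <= delta by rewrite ge_min lexx orbT.
have cJ : deriv_chain n `]x0, (x0 + d)[ (fun k => J^`(k)).
  apply: derivable_upto_chain => x; rewrite /= in_itv/= => /andP[xx0 xd].
  have := RLd x; rewrite /= distrC gtr0_norm ?subr_gt0// => /(_ ltac:(lra) xx0).
  by rewrite /RL_derivable alpha_neqn => -[].
have JL : J^`(n) x @[x --> x0^'+] --> c^-1 * L.
  have -> : J^`(n) = (fun x => c^-1 * (c * (J^`(n))%classic x)).
    by apply/funext => x; rewrite mulKf.
  exact: cvgMl_tmp.
have bJ x : `]x0, (x0 + d)[%classic x ->
    `|J x| <= M * abel_mass e * ((x - x0) ^+ n * (x - x0) `^ (1 - e)).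
  rewrite /= in_itv/= => xd.
  have {1}-> : x = x0 + (x - x0) by ring.
  apply: RL_integral_flat_le => //; first lra.
    by move=> z zx; apply: cg; lra.
  by move=> z zx; apply: gM; lra.
have := deriv_chain_lim0 d_gt0 e1 cJ bJ JL.
by move=> /eqP; rewrite mulf_eq0 invr_eq0 (negPf c0)/= => /eqP.
Qed.

End fractional.

(** * Integer order *)

Section integer_order.
Set Implicit Arguments.
Unset Strict Implicit.
Context {R : realType}.

(** The difference quotient at [x0] is a value of the derivative at an
    intermediate point. *)
Lemma deriv_chain_lim_right (D : nat -> R -> R) (x0 delta L : R) : 0 < delta ->
  deriv_chain 1 `](x0 - delta), (x0 + delta)[ D ->
  D 1%N x @[x --> x0^'+] --> L -> L = D 1%N x0.
Proof.
move=> d0 cD DL.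
have itvP x : `](x0 - delta), (x0 + delta)[%classic x <-> x0 - delta < x < x0 + delta.
  by rewrite /= in_itv.
have d1 : is_derive x0 1 (D 0) (D 1%N x0) by apply: cD => //; apply/itvP; lra.
have H1 : h^-1 *: (D 0 (h + x0) - D 0 x0) @[h --> (0:R)^'+] --> D 1%N x0.
  have := @ex_derive _ _ _ _ _ _ _ d1.
  rewrite -(@derive_val _ _ _ _ _ _ _ d1) -derive1E /derive1.
  rewrite /derivable; under eq_fun do rewrite scaler1.
  exact: cvg_dnbhs_at_right.
apply: cvg_unique H1 => //.
apply/cvgrPdist_lt => eps eps0.
move/cvgrPdist_lt : DL => /(_ _ eps0)[r /= r0 rL].
near=> h.
have h0 : 0 < h by near: h; exact: nbhs_right_gt.
have hr : h < r by near: h; exact: nbhs_right_lt.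
have hd : h < delta by near: h; exact: nbhs_right_lt.
have xh : x0 < x0 + h by rewrite ltrDl.
have dD z : z \in `[x0, x0 + h]%R -> is_derive z 1 (D 0) (D 1%N z).
  by rewrite in_itv/= => zx; apply: cD => //; apply/itvP; lra.
have dDo z : z \in `]x0, (x0 + h)%R[%R -> is_derive z 1 (D 0) (D 1%N z).
  by move=> zx; apply: dD; exact: subset_itv_oo_cc zx.
have cDn : {within `[x0, x0 + h], continuous (D 0)}.
  by apply: derivable_within_continuous => z /dD dz; exact: ex_derive.
have [z zx] := MVT xh dDo cDn.
rewrite [h + x0]addrC => ->; move: zx; rewrite in_itv/= => /andP[x0z zh].
rewrite (_ : x0 + h - x0 = h); last by ring.
rewrite /GRing.scale/= mulrCA mulVf ?mulr1 ?gt_eqF//.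
apply: rL => //=; rewrite distrC gtr0_norm ?subr_gt0//; lra.
Unshelve. all: by end_near. Qed.

End integer_order.

(** * The local fractional derivative *)

Section local_fractional.
Set Implicit Arguments.
Unset Strict Implicit.
Context {R : realType}.
Variables (n : nat) (x0 : R).
Hypothesis n_ge1 : (1 <= n)%N.
Implicit Types (f : R -> R).

Lemma near_itvP (P : R -> Prop) : (\forall x \near x0, P x) ->
  exists2 delta, 0 < delta & forall x, x0 - delta < x < x0 + delta -> P x.
Proof.
move=> /nbhs_ballP[d /= d0 dP]; exists d => // x xd; apply: dP.
by rewrite /ball/= ltr_distlC; lra.
Qed.

Lemma taylor_remainder_flat f : n_differentiable_near n x0 f ->
  exists delta M, [/\ 0 < delta <= 1, 0 <= M,
    deriv_chain n `](x0 - delta), (x0 + delta)[ (taylor_chain n x0 f) &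
    forall k, (k < n)%N -> forall z, x0 <= z < x0 + delta ->
      `|taylor_chain n x0 f k z| <= M * (z - x0) ^+ (n - k)].
Proof.
move=> /near_itvP[r r0 fr].
have cT : deriv_chain n `](x0 - r), (x0 + r)[ (taylor_chain n x0 f).
  by apply: taylor_chainP => x; rewrite /= in_itv/=; exact: fr.
have T0 k : (k <= n.-1)%N -> taylor_chain n x0 f k x0 = 0.
  move=> kn; have {}kn : (k < n)%N by rewrite (leq_ltn_trans kn)// prednK.
  by rewrite /taylor_chain -(subnSK kn) taylor_remainder_center.
have := deriv_chain_flat_bound r0 _ T0; rewrite prednK// => /(_ cT).
move=> [M [d [/andP[d0 dr] M0 bM]]].
exists (Num.min d 1), M.
have d1 : Num.min d 1 <= 1 by rewrite ge_min lexx orbT.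
have dd : Num.min d 1 <= d by rewrite ge_min lexx.
split=> //; first by rewrite d1 lt_min d0 ltr01.
  by apply: deriv_chainS cT => x; rewrite /= !in_itv/=; lra.
move=> k kn z zd; apply: bM; last by lra.
by rewrite -ltnS prednK.
Qed.

Lemma taylor_chain_top f : taylor_chain n x0 f n = f^`(n).
Proof. by apply/funext => x; rewrite /taylor_chain subnn taylor_remainder0. Qed.

Lemma taylor_chain_bottom f : taylor_chain n x0 f 0 = taylor_remainder n x0 f.
Proof. by rewrite /taylor_chain subn0. Qed.

Lemma taylor_chain_continuous f (delta : R) :
  deriv_chain n `](x0 - delta), (x0 + delta)[ (taylor_chain n x0 f) ->
  forall k, (k < n)%N -> forall z, x0 <= z < x0 + delta ->
    {for z, continuous (taylor_chain n x0 f k)}.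
Proof.
move=> cT k kn z zd; apply/differentiable_continuous/derivable1_diffP.
have dz := cT k kn z; apply: (@ex_derive _ _ _ _ _ _ _ (dz _)).
by rewrite /= in_itv/=; lra.
Qed.

Lemma near_right_itv (P : R -> Prop) (delta : R) : 0 < delta ->
  (forall x, x0 < x < x0 + delta -> P x) -> \forall x \near x0^'+, P x.
Proof.
move=> d0 dP; near=> x; apply: dP; apply/andP; split; near: x.
  exact: nbhs_right_gt.
by apply: nbhs_right_lt; lra.
Unshelve. all: by end_near. Qed.

Section noninteger.
Variable alpha : R.
Hypothesis alphan : n%:R - 1 < alpha < n%:R.

Lemma C_local_frac_derivable f : n_continuously_differentiable_near n x0 f ->
  local_frac_derivable n alpha f x0.
Proof.
move=> Cf.
have nf : n_differentiable_near n x0 f by apply: filterS Cf => x [].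
have [d [M [/andP[d0 d1] M0 cT bT]]] := taylor_remainder_flat nf.
have [r r0 Cr] := near_itvP Cf.
have [s s0 bs] : exists2 s, 0 < s & forall z, x0 - s < z < x0 + s ->
    `|(f^`(n))%classic z| <= `|(f^`(n))%classic x0| + 1.
  apply: near_itvP.
  have [_ /cvgrPdist_lt/(_ 1 ltr01) cf] := nbhs_singleton Cf.
  apply: filterS cf => z /ltW zx.
  rewrite -lerBlDl; apply: le_trans (lerB_dist _ _) _.
  by rewrite distrC.
pose delta := Num.min d (Num.min r s).
have delta0 : 0 < delta by rewrite !lt_min d0 r0 s0.
have [dd [dr ds]] : delta <= d /\ delta <= r /\ delta <= s.
  by rewrite !ge_min !lexx !orbT.
have [|||||dJ cJ] := @RL_derivative_flat _ _ _ alphan (taylor_chain n x0 f) x0 delta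
  (Num.max M (`|(f^`(n))%classic x0| + 1)).
- by rewrite delta0 (le_trans dd).
- by rewrite le_max M0.
- by apply: deriv_chainS cT => x; rewrite /= !in_itv/=; lra.
- move=> k; rewrite leq_eqVlt => /predU1P[->|kn] z zd; last first.
    by apply: (taylor_chain_continuous cT kn); lra.
  by rewrite taylor_chain_top; apply: (Cr z _).2; lra.
- move=> k; rewrite leq_eqVlt => /predU1P[->|kn] z zd.
    rewrite taylor_chain_top subnn expr0 mulr1 le_max; apply/orP; right.
    by apply: bs; lra.
  rewrite (le_trans (bT k kn z _))//; first lra.
  by rewrite ler_wpM2r ?exprn_ge0 ?subr_ge0 ?le_max ?lexx//; lra.
rewrite taylor_chain_bottom in dJ cJ; split; first exact: near_right_itv dJ.
by apply/cvg_ex; exists 0.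
Qed.

Lemma local_frac_derivative_eq0 f : n_differentiable_near n x0 f ->
  local_frac_derivable n alpha f x0 -> local_frac_derivative n alpha f x0 = 0.
Proof.
move=> nf [RLd RLc].
have [d [M [/andP[d0 d1] M0 cT bT]]] := taylor_remainder_flat nf.
rewrite /local_frac_derivative.
apply: (RL_derivative_flat_lim0 alphan d0 M0 _ _ RLd RLc) => z zd.
  rewrite -taylor_chain_bottom.
  exact: (taylor_chain_continuous cT).
by have := bT 0 n_ge1 z zd; rewrite subn0 taylor_chain_bottom.
Qed.

End noninteger.

Lemma RL_derivative_integer f (delta : R) :
  deriv_chain n `](x0 - delta), (x0 + delta)[ (taylor_chain n x0 f) ->
  forall x, x0 - delta < x < x0 + delta ->
    RL_derivative n n%:R x0 (taylor_remainder n x0 f) x = (f^`(n))%classic x /\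
    RL_derivable n n%:R x0 (taylor_remainder n x0 f) x.
Proof.
move=> cT x xd; rewrite /RL_derivative /RL_derivable eqxx.
have oI : open (`](x0 - delta), (x0 + delta)[ : set R) by exact: interval_open.
have TE y : `](x0 - delta), (x0 + delta)[%classic y ->
    taylor_remainder n x0 f y = taylor_chain n x0 f 0 y.
  by rewrite taylor_chain_bottom.
have xI : `](x0 - delta), (x0 + delta)[%classic x by rewrite /= in_itv.
split; last exact: deriv_chain_derivable oI cT TE xI.
by rewrite (deriv_chain_derive1n oI cT TE (leqnn n) xI) taylor_chain_top.
Qed.

Lemma C_local_frac_derivable_integer f :
  n_continuously_differentiable_near n x0 f ->
  local_frac_derivable n n%:R f x0.
Proof.
move=> Cf.
have nf : n_differentiable_near n x0 f by apply: filterS Cf => x [].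
have [d [M [/andP[d0 d1] _ cT _]]] := taylor_remainder_flat nf.
have RLE := RL_derivative_integer cT.
split; first by apply: (near_right_itv d0) => x xd; apply: (RLE x _).2; lra.
apply/cvg_ex; exists ((f^`(n))%classic x0).
have [_ cf] := nbhs_singleton Cf.
have /cvg_at_right_filter := cf; apply: cvg_trans; apply: near_eq_cvg.
by apply: (near_right_itv d0) => x xd; apply/esym; apply: (RLE x _).1; lra.
Qed.

Lemma local_frac_derivative_integer f : n_differentiable_near n x0 f ->
  local_frac_derivable n n%:R f x0 ->
  local_frac_derivative n n%:R f x0 = (f^`(n))%classic x0.
Proof.
move=> nf [_ RLc]; rewrite /local_frac_derivative.
have [d [M [/andP[d0 d1] _ cT _]]] := taylor_remainder_flat nf.
have RLE := RL_derivative_integer cT.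
have [r r0 fr] := near_itvP nf.
have cf : deriv_chain 1 `](x0 - r), (x0 + r)[ (fun k => f^`(n.-1 + k)).
  move=> [|//] _ x; rewrite /= in_itv/= addn0 addn1 => xr.
  by rewrite derive1nS derive1E; apply/derivableP/(fr x xr); rewrite prednK.
have -> : (f^`(n))%classic x0 = (f^`(n.-1 + 1))%classic x0 by rewrite addn1 prednK.
apply: (deriv_chain_lim_right r0 cf); rewrite addn1 prednK//.
apply: cvg_trans RLc; apply: near_eq_cvg.
by apply: (near_right_itv d0) => x xd; apply: (RLE x _).1; lra.
Qed.

End local_fractional.

(* The limit defining the local fractional derivative can fail to exist when
   f^(n) is discontinuous; the two alternatives therefore concern the functions
   for which it exists, and it is also asserted that it exists as soon as f^(n)
   is continuous near x0. *)
Theorem mainTheorem2 (R : realType) (n : nat) (alpha x0 : R)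
    (n_ge1 : (1 <= n)%N) (alpha_n : n%:R - 1 < alpha <= n%:R) :
  (forall f : R -> R, n_continuously_differentiable_near n x0 f ->
     local_frac_derivable n alpha f x0) /\
  ((forall f : R -> R, n_differentiable_near n x0 f ->
      local_frac_derivable n alpha f x0 ->
      local_frac_derivative n alpha f x0 = f^`(n) x0) \/
   (forall f : R -> R, n_differentiable_near n x0 f ->
      local_frac_derivable n alpha f x0 ->
      local_frac_derivative n alpha f x0 = 0)).
Proof.
have [alphaE|alpha_neq] := eqVneq alpha n%:R.
  rewrite alphaE; split=> [f|]; first exact: C_local_frac_derivable_integer.
  by left=> f; exact: local_frac_derivative_integer.
have alphan : n%:R - 1 < alpha < n%:R.
  by case/andP: alpha_n => -> /=; rewrite le_eqVlt (negPf alpha_neq).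
split=> [f|]; first exact: C_local_frac_derivable.
by right=> f; exact: local_frac_derivative_eq0.
Qed.
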